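(* Let $\mathcal{P}\subset\mathbb{R}^d$ be a generalized permutahedron. For $m\in\mathbb{Z}_{>0}$ let $$\chi_d(\mathcal{P})(m)=\#\{y\in[m]^d:\ \mathcal{P}_y \text{ is a vertex of }\mathcal{P}\},$$ the number of $\mathcal{P}$-generic directions $y$ with $y\in[m]^d=\{1,\dots,m\}^d$. Then $\chi_d(\mathcal{P})(m)$ agrees with a polynomial in $m$ of degree $d$, and for all $m\in\mathbb{Z}_{>0}$ $$(-1)^d\chi_d(\mathcal{P})(-m)=\sum_{y\in[m]^d}\#(\text{vertices of }\mathcal{P}_y).$$
   Context: Directions $y\in(\mathbb{R}^d)^*\cong\mathbb{R}^d$ act by $y(x)=\sum_i y_ix_i$. For a polytope $\mathcal{P}$ the $y$-maximal face is $\mathcal{P}_y=\{x\in\mathcal{P}: y(x)\ge y(x')\ \forall x'\in\mathcal{P}\}$; $y$ is $\mathcal{P}$-generic if $\mathcal{P}_y$ is a single vertex. The normal cone of a face $F$ is $N_\mathcal{P}(F)=\{y:\mathcal{P}_y\supseteq F\}$ and the normal fan $\mathcal{N}(\mathcal{P})$ is the set of all normal cones. The braid fan in $\mathbb{R}^d$ consists of the cones $\{y: y_i=y_j \text{ for } i,j\in T_a;\ y_i\ge y_j \text{ for } i\in T_a,j\in T_b,a<b\}$ for ordered set compositions $(T_1,\dots,T_k)$ of $[d]$; it is the normal fan of the standard permutahedron $\mathrm{conv}\{(\sigma(1),\dots,\sigma(d)):\sigma\in S_d\}$. A polytope $\mathcal{P}\subset\mathbb{R}^d$ is a generalized permutahedron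 if its normal fan is a coarsening of the braid fan, i.e. every cone of $\mathcal{N}(\mathcal{P})$ is a union of braid cones. *)

(* Defs.v *)
From HB Require Import structures.
From mathcomp Require Import all_boot all_order all_algebra.
From mathcomp Require Import boolp classical_sets.
Set Implicit Arguments. Unset Strict Implicit. Unset Printing Implicit Defensive.
Import Order.TTheory GRing.Theory Num.Theory.
Local Open Scope ring_scope.
Local Open Scope classical_set_scope.

Section Defs.
Variables (R : realFieldType) (d : nat).
Notation pt := 'rV[R]_d.

Definition pairing (y x : pt) : R := \sum_(i < d) y 0 i * x 0 i.

Definition conv (V : seq pt) : set pt :=
  [set x | exists l : 'I_(size V) -> R,
     (forall i, 0 <= l i) /\ \sum_i l i = 1 /\ x = \sum_i l i *: V`_i].

Definition maxface (P : set pt) (y : pt) : set pt :=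
  [set x | P x /\ forall x', P x' -> pairing y x' <= pairing y x].

Definition generic (P : set pt) (y : pt) : Prop :=
  exists x, maxface P y = [set x].

Definition is_vertex (Q : set pt) (x : pt) : Prop :=
  exists z, maxface Q z = [set x].

Definition normal_cone (P : set pt) (F : set pt) : set pt :=
  [set y | F `<=` maxface P y].

(* ordered set composition (T_1,...,T_k) of [d], encoded by block index c i
   (T_{a+1} = c^{-1}(a)), with blocks 0..k-1 all nonempty *)
Definition osc (c : 'I_d -> nat) : Prop :=
  exists k, (forall i, (c i < k)%N) /\ (forall a, (a < k)%N -> exists i, c i = a).

Definition braid_cone (c : 'I_d -> nat) : set pt :=
  [set y | (forall i j, c i = c j -> y 0 i = y 0 j) /\
           (forall i j, (c i < c j)%N -> y 0 j <= y 0 i)].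

Definition genperm (P : set pt) : Prop :=
  forall z, exists S : set ('I_d -> nat), (forall c, S c -> osc c) /\
    normal_cone P (maxface P z) = \bigcup_(c in S) braid_cone c.

Definition ptof (m : nat) (y : {ffun 'I_d -> 'I_m}) : pt :=
  \row_i ((y i).+1)%:R.

Definition chi (P : set pt) (m : nat) : nat :=
  #|[pred y : {ffun 'I_d -> 'I_m} | `[< generic P (ptof y) >] ]|.

(* number of vertices of a face Q of conv V; every vertex of such a Q
   lies in V, so we count the distinct elements of V that are vertices of Q *)
Definition nvert (V : seq pt) (Q : set pt) : nat :=
  size (undup [seq v <- V | `[< is_vertex Q v >] ]).

End Defs.

(* Main.v *)
Require Import Defs.
From HB Require Import structures.
From mathcomp Require Import all_boot all_order all_algebra all_fingroup.
From mathcomp Require Import boolp classical_sets reals.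
From mathcomp Require Import ring lra zify.
Import Order.TTheory GRing.Theory Num.Theory.
Local Open Scope ring_scope.

(** For a generalized permutahedron the maximal face [P_y] depends only on the
order type of [y].  The order type of [K y + w] for large [K] is the
lexicographic one of [(y, w)], and then [P_(K y + w) = (P_y)_w].  Fix for each
vertex [v] a vector [w_v] with distinct coordinates and [P_(w_v) = {v}].  Then
[v] lies in [P_y] iff the order type of [(y, w_v)] selects [v], and [P_y = {v}]
iff that of [(y, - w_v)] does.  Since every permutation [s] selects exactly one
vertex [v_s], both counts become sums over [s] of the number of [y] in [[m]^d]
for which [(y, w)], with [w = w_(v_s)] or [- w_(v_s)], has order type [s].  That
number is ['C(m + asc, d)], where [asc] counts the ascents of [w] along [s].
Negating [w] exchanges ascents and descents, whose numbers add up to [d - 1], so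
the theorem reduces to the reciprocity
[(-1)^d 'C(- m + e, d) = 'C(m + (d - 1 - e), d)]. *)

(** * Maximal faces, order types of directions and lexicographic refinement *)

Section Faces.
Set Implicit Arguments.
Unset Strict Implicit.
Local Open Scope classical_set_scope.
Variables (R : realFieldType) (d : nat).
Implicit Types (y w u x : 'rV[R]_d) (P : set 'rV[R]_d) (V : seq 'rV[R]_d).

Lemma pairing_comb (a : R) y w x :
  pairing (a *: y + w) x = a * pairing y x + pairing w x.
Proof.
rewrite /pairing mulr_sumr -big_split; apply: eq_bigr => i _ /=.
by rewrite !mxE mulrDl mulrA.
Qed.

Lemma pairingN y x : pairing (- y) x = - pairing y x.
Proof. by rewrite /pairing -sumrN; apply: eq_bigr => i _; rewrite mxE mulNr. Qed.

Lemma pairing_sumr n (l : 'I_n -> R) (v : 'I_n -> 'rV[R]_d) y :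
  pairing y (\sum_i l i *: v i) = \sum_i l i * pairing y (v i).
Proof.
rewrite /pairing; under eq_bigr do rewrite summxE mulr_sumr.
rewrite exchange_big; apply: eq_bigr => i _; rewrite mulr_sumr.
by apply: eq_bigr => j _; rewrite mxE; ring.
Qed.

Lemma pairing_delta (i : 'I_d) x : pairing (delta_mx 0 i) x = x 0 i.
Proof.
rewrite /pairing (bigD1 i) //= mxE !eqxx mul1r big1 ?addr0 // => j ne.
by rewrite mxE (negPf ne) andbF mul0r.
Qed.

(** Besides showing that maximal faces are nonempty, this puts the point of a one-point maximal face
    in [V], as [nvert] requires. *)
Lemma maxface_conv V y : V != [::] -> exists2 v, v \in V & maxface (conv V) y v.
Proof.
case: V => // v0 V' _; set V := v0 :: V'.
pose k := [arg max_(i > (ord0 : 'I_(size V))) pairing y V`_i]%O.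
have kmax (i : 'I_(size V)) : pairing y V`_i <= pairing y V`_k.
  by rewrite /k; case: arg_maxP => //= j _; apply.
exists V`_k; first exact: mem_nth.
split.
  exists (fun i => (i == k)%:R); split; first by move=> i; rewrite ler0n.
  split.
    by rewrite (bigD1 k) //= eqxx big1 ?addr0 // => i /negPf ->.
  rewrite (bigD1 k) //= eqxx scale1r big1 ?addr0 // => i /negPf ->.
  by rewrite scale0r.
move=> _ [l [l0 [l1 ->]]]; rewrite pairing_sumr -[leRHS]mul1r -l1 mulr_suml.
by apply: ler_sum => i _; apply: ler_wpM2l.
Qed.

(** The normal cone of [P_y] is a union of braid cones, one of which contains [y]. Membership in a
    braid cone involves only comparisons of coordinates, so that cone contains [u] too, whence [P_y]
    lies in [P_u]. The other inclusion is symmetric. *)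
Lemma maxface_same_order P y u : genperm P ->
  (forall i j, (y 0 i <= y 0 j) = (u 0 i <= u 0 j)) -> maxface P y = maxface P u.
Proof.
move=> gp; suff sub y' u' : (forall i j, (y' 0 i <= y' 0 j) = (u' 0 i <= u' 0 j)) ->
    maxface P y' `<=` maxface P u'.
  by move=> yu; apply/seteqP; split; apply: sub => // i j; rewrite yu.
move=> yu; have [S [_ NS]] := gp y'.
have : normal_cone P (maxface P y') y' by [].
have : (normal_cone P (maxface P y') u' -> maxface P y' `<=` maxface P u') by [].
rewrite NS => h [c Sc [ceq clt]]; apply: h; exists c => //; split => i j.
  move/ceq/eqP; rewrite eq_le !yu => /andP[? ?].
  by apply/eqP; rewrite eq_le; apply/andP.
by move/clt; rewrite yu.
Qed.

Definition lexle y w (i j : 'I_d) :=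
  (y 0 i < y 0 j) || (y 0 i == y 0 j) && (w 0 i <= w 0 j).

Lemma lexle_eventually y w : exists K0 : R, forall K, K0 <= K ->
  forall i j, ((K *: y + w) 0 i <= (K *: y + w) 0 j) = lexle y w i j.
Proof.
(* Beyond this ratio the gap in [y] outweighs the one in [w]. For equal [y] coordinates the quotient
   by zero is 0, which is harmless in the sum below. *)
pose g (i j : 'I_d) := `|w 0 i - w 0 j| / `|y 0 i - y 0 j|.
have g0 i j : 0 <= g i j by rewrite divr_ge0.
exists (1 + \sum_i \sum_j g i j) => K KK.
have gK i j : g i j < K.
  apply: lt_le_trans KK; rewrite ltr_pwDl //.
  rewrite (bigD1 i) //= (bigD1 j) //= -addrA lerDl addr_ge0 ?sumr_ge0 // => a _.
  by rewrite sumr_ge0.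
have lt i j : y 0 i < y 0 j -> K * y 0 i + w 0 i < K * y 0 j + w 0 j.
  move=> yij; have := gK i j; rewrite /g ltr_pdivrMr; last first.
    by rewrite normr_gt0 subr_eq0 lt_eqF.
  rewrite [X in _ < K * X]distrC [X in _ < K * X]gtr0_norm ?subr_gt0 //.
  have := ler_norm (w 0 i - w 0 j); lra.
move=> i j; rewrite !mxE /lexle.
case: (ltgtP (y 0 i) (y 0 j)) => /= [/lt/ltW -> //|/lt|->].
  by rewrite ltNge => /negbTE.
by rewrite lerD2l.
Qed.

Lemma ge0_of_eventually (K0 a b : R) :
  (forall K, K0 <= K -> 0 <= K * a + b) -> 0 <= a.
Proof.
move=> h; rewrite leNgt; apply/negP => a0.
(* If [a < 0], this [K] makes [K * a + b] at most -1. *)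
have := h (Num.max K0 ((1 + `|b|) / - a)); rewrite le_max lexx => /(_ isT).
have : (1 + `|b|) / - a <= Num.max K0 ((1 + `|b|) / - a) by rewrite le_max lexx orbT.
rewrite ler_pdivrMr ?oppr_gt0 //; have := ler_norm b; lra.
Qed.

(** The direction [u] has the order type of [K *: y + w] for every large [K], so a point of [P_u]
    maximizes all of these at once. Letting [K] grow shows that it maximizes [y], and among the
    maximizers of [y] it must then maximize [w]. *)
Lemma maxface_lex P y w u : genperm P -> (forall z, exists x, maxface P z x) ->
  (forall i j, (u 0 i <= u 0 j) = lexle y w i j) ->
  maxface P u = maxface (maxface P y) w.
Proof.
move=> gp ne ulex; have [K0 lexK] := lexle_eventually y w.
have uK K : K0 <= K -> maxface P u = maxface P (K *: y + w).
  by move=> /lexK h; apply: maxface_same_order => // i j; rewrite ulex h.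
have sub x : maxface P u x -> maxface (maxface P y) w x.
  move=> ux; have xy : maxface P y x.
    split=> [|x' Px']; first by case: ux.
    rewrite -subr_ge0.
    apply: (@ge0_of_eventually K0 _ (pairing w x - pairing w x')) => K KK.
    move: ux; rewrite (uK K KK) => -[_ /(_ _ Px')]; rewrite !pairing_comb; lra.
  split=> // x' [Px' x'max]; move: ux; rewrite (uK K0) // => -[_ /(_ _ Px')].
  have := x'max x xy.1; have := xy.2 x' Px'; rewrite !pairing_comb => h1 h2.
  have -> : pairing y x = pairing y x' by apply/eqP; rewrite eq_le h1 h2.
  by rewrite lerD2l.
(* Conversely, [x] and a point [x0] of [P_u] both lie in [(P_y)_w], so [y] and [w] take the same
   values at them, and so does [K0 *: y + w]. *)
apply/seteqP; split=> // x [xy xw]; have [x0 ux0] := ne u.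
have [x0y x0w] := sub x0 ux0.
move: ux0; rewrite (uK K0) // => -[_ x0max]; split; first by case: xy.
move=> x' /x0max; have := xw _ x0y; have := x0w _ xy.
have := xy.2 _ x0y.1; have := x0y.2 _ xy.1; rewrite !pairing_comb => h1 h2 h3 h4.
have -> : pairing y x0 = pairing y x by apply/eqP; rewrite eq_le h1 h2.
by have -> : pairing w x0 = pairing w x by apply/eqP; rewrite eq_le h3 h4.
Qed.

Lemma maxface_maxface P y w v : maxface P w = [set v] ->
  maxface (maxface P y) w = [set v] <-> maxface P y v.
Proof.
move=> wv; have vw : maxface P w v by rewrite wv.
split=> [h|yv]; first by have [] : maxface (maxface P y) w v by rewrite h.
apply/seteqP; split=> [x [[Px _] xw]|_ ->].
  rewrite -wv; split=> // x' /vw.2/le_trans; apply; exact: xw.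
by split=> // x' [Px' _]; apply: vw.2.
Qed.

(** If [v] maximizes [- w] on [P_y], then [w] is at least its value at [v] on all of [P_y]. That
    value is the maximum over [P], attained only at [v], so [P_y] has no other point. *)
Lemma maxface_maxfaceN P y w v : maxface P w = [set v] ->
  maxface (maxface P y) (- w) = [set v] <-> maxface P y = [set v].
Proof.
move=> wv; have vw : maxface P w v by rewrite wv.
split=> [h|->]; last first.
  by apply/seteqP; split=> [x [-> _]|_ ->]; [|split=> [|_ ->]].
have [vy vNw] : maxface (maxface P y) (- w) v by rewrite h.
apply/seteqP; split=> [x yx|_ ->] //.
rewrite -wv; split; first by case: yx.
move=> x' /vw.2/le_trans; apply.
by have := vNw x yx; rewrite !pairingN lerN2.
Qed.

(** A vertex of [P_y] exposed by [z] is exposed in [P] by [K *: y + z] for large [K], by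
    [maxface_lex]. *)
Lemma is_vertex_maxface P y v : genperm P -> (forall z, exists x, maxface P z x) ->
  is_vertex (maxface P y) v <-> maxface P y v /\ is_vertex P v.
Proof.
move=> gp ne; split=> [[z zv]|[yv [z zv]]]; last first.
  by exists z; apply/maxface_maxface.
split; first by have [] : maxface (maxface P y) z v by rewrite zv.
have [K0 lexK] := lexle_eventually y z.
by exists (K0 *: y + z); rewrite -zv; apply: maxface_lex => //; apply: lexK.
Qed.

(** A representative of the open braid chamber of order type [s]. *)
Definition perm_vec (s : 'S_d) : 'rV[R]_d := \row_i (s i : nat)%:R.

Lemma perm_vec_le s i j : (perm_vec s 0 i <= perm_vec s 0 j) = (s i <= s j)%N.
Proof. by rewrite !mxE ler_nat. Qed.

Lemma perm_vec_inj s : injective (perm_vec s 0).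
Proof.
move=> i j /eqP; rewrite !mxE eqr_nat => /eqP/val_inj.
exact: perm_inj.
Qed.

(* Adding a unit vector to twice a permutation vector does not change its order
   type, so a maximal face spans no direction with a nonzero coordinate. *)
Lemma maxface_perm_vec P s : genperm P -> (forall z, exists x, maxface P z x) ->
  generic P (perm_vec s).
Proof.
move=> gp ne; have [x xs] := ne (perm_vec s); exists x.
apply/seteqP; split=> [x' x's|_ ->] //; apply/rowP => i.
have eqf u : (forall a b, (perm_vec s 0 a <= perm_vec s 0 b) = (u 0 a <= u 0 b)) ->
    pairing u x = pairing u x'.
  move=> /(maxface_same_order gp) E; move: xs x's; rewrite E => -[Px h] [Px' h'].
  by apply/eqP; rewrite eq_le h ?h'.
have e1 := eqf _ (fun a b => erefl).
have := eqf (2%:R *: perm_vec s + delta_mx 0 i).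
rewrite !pairing_comb !pairing_delta e1 => h.
apply/esym; apply: (addrI (2%:R * pairing (perm_vec s) x')); apply: h => a b.
rewrite perm_vec_le !mxE -!natrM -!natrD ler_nat !eqxx /=.
have [<-|neab] := eqVneq a b; first by rewrite !leqnn.
have : (s a != s b :> nat)%N by apply: contra neab => /eqP/val_inj/perm_inj ->.
case: (a == i); case: (b == i); lia.
Qed.

Lemma lexle_total y w i j : lexle y w i j || lexle y w j i.
Proof.
rewrite /lexle; case: (ltgtP (y 0 i) (y 0 j)) => //= _; exact: le_total.
Qed.

Lemma lexle_trans y w : transitive (lexle y w).
Proof.
move=> j i k /orP[ij|/andP[/eqP ij wij]] /orP[jk|/andP[/eqP jk wjk]];
  rewrite /lexle.
- by rewrite (lt_trans ij jk).
- by rewrite -jk ij.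
- by rewrite ij jk.
- by rewrite ij jk eqxx (le_trans wij wjk) orbT.
Qed.

Lemma lexle_anti y w : injective (w 0) -> antisymmetric (lexle y w).
Proof.
move=> wi i j; rewrite /lexle; case: (ltgtP (y 0 i) (y 0 j)) => //= _.
by rewrite -eq_le => /eqP/wi.
Qed.

End Faces.

(** * Total orders on the indices as permutations *)

Section Orders.
Set Implicit Arguments.
Unset Strict Implicit.
Variable d : nat.
Implicit Types (r : rel 'I_d) (s : 'S_d).

Definition perm_of_rel s r := [forall i, forall j, (s i <= s j)%N == r i j].

Lemma perm_of_relP s r :
  reflect (forall i j, (s i <= s j)%N = r i j) (perm_of_rel s r).
Proof.
apply: (iffP forallP) => h i; last by apply/forallP => j; rewrite h.
by move=> j; have /forallP/(_ j)/eqP := h i.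
Qed.

Lemma perm_of_rel_exists r : total r -> transitive r -> antisymmetric r ->
  exists s, perm_of_rel s r.
Proof.
move=> rtot rtr ranti.
have rr : reflexive r by move=> i; have := rtot i i; rewrite orbb.
(* The permutation sends [i] to its rank, the number of elements strictly below it. *)
pose f i := #|[pred j | r j i && (j != i)]|.
have fd i : (f i < d)%N.
  rewrite -[X in (_ < X)%N]card_ord; apply: proper_card.
  by apply/properP; split; [apply/fintype.subsetP | exists i; rewrite // inE eqxx andbF].
have flt i j : r i j -> i != j -> (f i < f j)%N.
  move=> rij nij; apply: proper_card; apply/properP; split; last first.
    by exists i; rewrite !inE ?eqxx ?andbF // rij nij.
  apply/fintype.subsetP => k; rewrite !inE => /andP[rki nki]; rewrite (rtr _ _ _ rki rij).
  by apply: contra nij => /eqP kj; apply/eqP/ranti; rewrite rij -kj rki.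
have finj : injective (fun i => Ordinal (fd i)).
  move=> i j [fij]; apply/eqP/negPn/negP => nij.
  case/orP: (rtot i j) => /flt; rewrite ?nij 1?eq_sym ?nij fij => /(_ isT).
    by rewrite ltnn.
  by rewrite ltnn.
exists (perm finj); apply/perm_of_relP => i j; rewrite !permE /=.
have [<-|nij] := eqVneq i j; first by rewrite leqnn rr.
have [rij|/negbTE nrij] := boolP (r i j); first by rewrite ltnW ?flt.
have := rtot i j; rewrite nrij /= => /flt; rewrite eq_sym => /(_ nij).
by rewrite ltnNge => /negbTE.
Qed.

Lemma perm_of_rel_unique r s s' :
  perm_of_rel s r -> perm_of_rel s' r -> s = s'.
Proof.
move=> /perm_of_relP h /perm_of_relP h'.
have val_card (t : 'S_d) i : (t i : nat) = #|[pred j | (t j < t i)%N]|.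
  rewrite -sum1_card -[LHS]card_ord -sum1_card (big_ord_widen d (fun=> 1%N)) 1?ltnW //.
  by rewrite (reindex_inj (@perm_inj _ t)).
apply/permP => i; apply: val_inj; rewrite /= (val_card s) (val_card s').
by apply: eq_card => j; rewrite !inE !ltnNge h h'.
Qed.
End Orders.

(** * Counting lattice points of a given lexicographic order type *)

Section Counting.
Set Implicit Arguments.
Unset Strict Implicit.
Local Open Scope nat_scope.
Variable d : nat.
Implicit Types (r : rel 'I_d).

Lemma card_increasing n :
  #|[pred y : {ffun 'I_d -> 'I_n} | [forall i : 'I_d, forall j : 'I_d, (i < j) ==> (y i < y j)]]|
    = 'C(n, d).
Proof.
rewrite -card_ltn_sorted_tuples -!sum1_card.
rewrite (reindex (fun t : d.-tuple 'I_n => [ffun i => tnth t i])) /=; last first.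
  exists (fun y => [tuple y i | i < d]) => [t _|y _].
    by apply: eq_from_tnth => i; rewrite tnth_mktuple ffunE.
  by apply/ffunP => i; rewrite ffunE tnth_mktuple.
apply: eq_bigl => t; rewrite !inE (sorted_pairwise ltn_trans).
have nthE (i : 'I_d) : nth 0 [seq val x | x <- t] i = tnth t i.
  by rewrite (nth_map (tnth t i)) ?size_tuple // -tnth_nth.
apply/idP/(pairwiseP 0) => [/forallP h i j|h].
  rewrite !inE size_map size_tuple => id jd ij.
  have /forallP/(_ (Ordinal jd))/implyP/(_ ij) := h (Ordinal id).
  by rewrite !ffunE -!nthE.
apply/forallP => i; apply/forallP => j; apply/implyP => ij; rewrite !ffunE -!nthE.
by apply: h => //; rewrite inE size_map size_tuple.
Qed.

Lemma ord_lt_ind (P : rel 'I_d) : transitive P ->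
  (forall i j : 'I_d, j = i.+1 :> nat -> P i j) -> forall i j : 'I_d, i < j -> P i j.
Proof.
move=> Ptr Padj i [j jd] /=; elim: j jd => // j IH jd.
rewrite ltnS leq_eqVlt => /orP[/eqP ij|ij]; first by apply: Padj; rewrite ij.
exact: Ptr (IH (ltnW jd) ij) (Padj _ _ _).
Qed.

(** Indexing by a natural number avoids carrying a proof of [k.+1 < d]; the value is false when
    [k.+1] is out of range. *)
Definition ascent r (k : nat) : bool :=
  [exists i : 'I_d, exists j : 'I_d, [&& i == k :> nat, j == k.+1 :> nat & r i j]].

Definition ascents_below r (i : nat) : nat := \sum_(k < i) ascent r k.

Definition ascents r := ascents_below r d.-1.

Lemma ascentE r (i j : 'I_d) : j = i.+1 :> nat -> ascent r i = r i j.
Proof.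
move=> ji; apply/existsP/idP => [[i' /existsP[j' /and3P[/eqP/val_inj -> /eqP]]]|rij].
  by rewrite -ji => /val_inj ->.
by exists i; apply/existsP; exists j; rewrite eqxx ji eqxx.
Qed.

Lemma ascents_belowS r i : ascents_below r i.+1 = ascents_below r i + ascent r i.
Proof. by rewrite /ascents_below big_ord_recr. Qed.

Lemma ascents_belowD r i j : i <= j ->
  ascents_below r i <= ascents_below r j <= ascents_below r i + (j - i).
Proof.
move/subnKC <-; elim: (j - i) => [|k IH]; first by rewrite addn0; lia.
rewrite addnS ascents_belowS; case: (ascent _ _); lia.
Qed.

(** Each of the [d.-1] consecutive pairs is an ascent of exactly one of [r] and its reverse. *)
Lemma ascents_rev r : total r -> antisymmetric r ->
  ascents r + ascents (fun i j => r j i) = d.-1.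
Proof.
move=> rtot ranti; rewrite /ascents /ascents_below -big_split /=.
rewrite -[RHS]muln1 -[X in _ = X * _]card_ord -sum_nat_const; apply: eq_bigr => k _.
have kd : k.+1 < d by have := ltn_ord k; lia.
pose i := Ordinal (ltnW kd); pose j := Ordinal kd.
rewrite (@ascentE r i j) // (@ascentE (fun i j => r j i) i j) //.
case rij: (r i j); case rji: (r j i) => //.
  by have /(congr1 val)/= := ranti i j (introT andP (conj rij rji)); lia.
by have := rtot i j; rewrite rij rji.
Qed.

Definition lexnat m (y : {ffun 'I_d -> 'I_m}) r (i j : 'I_d) :=
  (y i < y j) || (y i == y j) && r i j.

(* Adding to each entry the number of ascents below its index turns the
   lexicographic condition into strict monotonicity. *)
Lemma lexnat_increasing m (y : {ffun 'I_d -> 'I_m}) r :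
    total r -> transitive r -> antisymmetric r ->
  (forall i j : 'I_d, (i <= j) = lexnat y r i j) <->
  (forall i j : 'I_d, i < j -> y i + ascents_below r i < y j + ascents_below r j).
Proof.
move=> rtot rtr ranti; split=> h i j.
  apply: (@ord_lt_ind (fun i j => y i + ascents_below r i < y j + ascents_below r j)).
    by move=> b a c; apply: ltn_trans.
  move=> {}i {}j ji; rewrite {1}ji ascents_belowS (ascentE r ji).
  have : lexnat y r i j by rewrite -h ji.
  by rewrite /lexnat => /orP[|/andP[/eqP -> ->]]; lia.
have ltr : transitive (lexnat y r).
  move=> b a c; rewrite /lexnat -!val_eqE /=.
  by case/orP=> [ab|/andP[ab rab]]; case/orP=> [bc|/andP[bc rbc]];
    (try (apply/orP; left; lia)); rewrite (rtr _ _ _ rab rbc); lia.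
have lex (a b : 'I_d) : a < b -> lexnat y r a b.
  apply: ord_lt_ind => // {}a {}b ba.
  have := h a b; rewrite {1 2}ba ascents_belowS (ascentE r ba) /lexnat -val_eqE /=.
  by case: (r a b) => /(_ (leqnn _)); lia.
case: (ltngtP i j) => [/lex -> //|/[dup] ji /lex|/val_inj ->].
  rewrite /lexnat -!val_eqE /= => /orP[|/andP[yji rji]]; first by lia.
  case rij: (r i j); last by lia.
  by have := ranti i j; rewrite rij rji => /(_ isT) E; rewrite E ltnn in ji.
by rewrite /lexnat eqxx /=; have := rtot j j; rewrite orbb => ->; rewrite orbT.
Qed.

Lemma increasing_gap (f : 'I_d -> nat) : (forall i j : 'I_d, i < j -> f i < f j) ->
  forall i j : 'I_d, i <= j -> f i + (j - i) <= f j.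
Proof.
move=> finc i j; rewrite leq_eqVlt => /orP[/eqP/val_inj ->|ij]; first by lia.
suff /andP[] : (i <= j) && (f i + (j - i) <= f j) by [].
apply: (@ord_lt_ind (fun i j => (i <= j) && (f i + (j - i) <= f j))) ij.
  by move=> b a c; lia.
by move=> {}i {}j ji; have := finc i j; lia.
Qed.

(** Adding [ascents_below r] is a bijection from these [y] onto the strictly increasing maps into
    ['I_(m + ascents r)]. *)
Lemma card_lexnat m r : total r -> transitive r -> antisymmetric r ->
  #|[pred y : {ffun 'I_d -> 'I_m} | [forall i : 'I_d, forall j : 'I_d, (i <= j) == lexnat y r i j]]|
    = 'C(m + ascents r, d).
Proof.
move=> rtot rtr ranti; rewrite -card_increasing.
have lt (y : {ffun 'I_d -> 'I_m}) (i : 'I_d) :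
    y i + ascents_below r i < m + ascents r.
  have := @ascents_belowD r i d.-1; have := ltn_ord i; have := ltn_ord (y i).
  rewrite /ascents; lia.
pose phi (y : {ffun 'I_d -> 'I_m}) := [ffun i => Ordinal (lt y i)].
have phi_inj : injective phi.
  move=> y z /ffunP yz; apply/ffunP => i; apply: val_inj.
  by have := congr1 val (yz i); rewrite !ffunE /=; lia.
rewrite -[LHS]cardsE -[RHS]cardsE -(card_imset _ phi_inj); apply: eq_card => f.
rewrite !inE; apply/imsetP/forallP => [[y + ->]|h].
  rewrite inE => /forallP h i; apply/forallP => j; apply/implyP; rewrite !ffunE.
  by apply: (proj1 (lexnat_increasing y rtot rtr ranti)) => a b;
    have /forallP/(_ b)/eqP := h a.
have finc (i j : 'I_d) : i < j -> f i < f j by have /forallP/(_ j)/implyP := h i.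
have gap := increasing_gap finc.
(* The shift can be undone within ['I_m]. Below, [ascents_below r i <= i <= f i]. Above,
   [f i + (d.-1 - i)] is less than [m + ascents r], and at most [d.-1 - i] ascents remain from [i]
   on. *)
have bnd (i : 'I_d) : ascents_below r i <= f i /\ f i - ascents_below r i < m.
  have d0 : 0 < d by apply: leq_ltn_trans (ltn_ord i).
  have d1 : d.-1 < d by rewrite prednK.
  have id1 : i <= d.-1 by have := ltn_ord i; lia.
  have g0 : f (Ordinal d0) + (i - 0) <= f i := gap (Ordinal d0) i (leq0n _).
  have g1 : f i + (d.-1 - i) <= f (Ordinal d1) := gap i (Ordinal d1) id1.
  have a0 : ascents_below r 0 = 0 by rewrite /ascents_below big_ord0.
  have := @ascents_belowD r 0 i (leq0n _); have := ascents_belowD r id1.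
  have := ltn_ord (f (Ordinal d1)); rewrite -/(ascents r) a0.
  lia.
pose y := [ffun i => Ordinal (bnd i).2].
have yE i : f i = y i + ascents_below r i :> nat.
  by rewrite ffunE /= subnK //; case: (bnd i).
exists y; last by apply/ffunP => i; apply: val_inj; rewrite ffunE /= yE.
rewrite inE; apply/forallP => i; apply/forallP => j; apply/eqP.
by apply: (proj2 (lexnat_increasing y rtot rtr ranti)) => a b; rewrite -!yE; apply: finc.
Qed.

End Counting.

(** * Binomial counts per permutation and their reciprocity *)

Section Reciprocity.
Set Implicit Arguments.
Unset Strict Implicit.
Variables (R : realFieldType) (d : nat).
Implicit Types (w : 'rV[R]_d) (m e : nat).

Lemma perm_of_lexle_exists y w : injective (w 0) -> exists s, perm_of_rel s (lexle y w).
Proof.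
move=> wi; apply: perm_of_rel_exists; first exact: lexle_total.
  exact: lexle_trans.
exact: lexle_anti.
Qed.

Definition ascents_wrt w (s : 'S_d) : nat :=
  ascents (fun i j => w 0 ((s^-1)%g i) <= w 0 ((s^-1)%g j)).

(** Relabelling the indices by [s] turns the order type [s] into the identity and [w] into [w]
    composed with the inverse of [s], the case of [card_lexnat]. *)
Lemma card_lexle w s m : injective (w 0) ->
  #|[pred y : {ffun 'I_d -> 'I_m} | perm_of_rel s (lexle (ptof R y) w)]|
    = 'C(m + ascents_wrt w s, d).
Proof.
move=> wi; rewrite -card_lexnat; last 3 first.
- by move=> i j; apply: le_total.
- by move=> j i k; apply: le_trans.
- by move=> i j; rewrite -eq_le => /eqP/wi/perm_inj.
rewrite -!sum1_card (reindex (fun y : {ffun 'I_d -> 'I_m} => [ffun i => y (s i)])) /=.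
  apply: eq_bigl => y; rewrite !inE.
  apply/perm_of_relP/forallP => [h i|h i j].
    apply/forallP => j; apply/eqP.
    have := h ((s^-1)%g i) ((s^-1)%g j).
    by rewrite !permKV => ->; rewrite /lexle /lexnat !mxE !ffunE !permKV ltr_nat eqr_nat.
  have /forallP/(_ (s j))/eqP -> := h (s i).
  by rewrite /lexle /lexnat !mxE !ffunE !permK ltr_nat eqr_nat.
exists (fun y : {ffun 'I_d -> 'I_m} => [ffun i => y ((s^-1)%g i)]) => y _;
  by apply/ffunP => i; rewrite !ffunE ?permK ?permKV.
Qed.

Lemma ascents_wrtN w s : injective (w 0) ->
  (ascents_wrt w s + ascents_wrt (- w) s = d.-1)%N.
Proof.
move=> wi; rewrite -(@ascents_rev _ (fun i j => w 0 ((s^-1)%g i) <= w 0 ((s^-1)%g j))).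
- congr (_ + ascents _)%N; apply/funext => i; apply/funext => j.
  by rewrite !mxE lerN2.
- by move=> i j; apply: le_total.
- by move=> i j; rewrite -eq_le => /eqP/wi/perm_inj.
Qed.

(** The falling factorial of length [d] of ['X + e], that is, [d!] times the binomial polynomial. *)
Definition ffact_poly e : {poly R} := \prod_(i < d) ('X - (i%:R - e%:R)%:P).

Lemma size_ffact_poly e : size (ffact_poly e) = d.+1.
Proof. by rewrite size_prod_XsubC /index_enum -enumT size_enum_ord. Qed.

Lemma coef_ffact_poly e : (ffact_poly e)`_d = 1.
Proof.
by have /monicP := monic_prod_XsubC (index_enum 'I_d) xpredT (fun i => i%:R - e%:R : R);
  rewrite lead_coefE -/(ffact_poly e) size_ffact_poly.
Qed.

Lemma natr_ffact n : (n ^_ d)%:R = \prod_(i < d) (n%:R - i%:R) :> R.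
Proof.
rewrite ffact_prod natr_prod; have [dn|nd] := leqP d n.
  by apply: eq_bigr => i _; rewrite natrB // ltnW // (leq_trans (ltn_ord i)).
(* For [n < d] natural subtraction truncates, but both products vanish through their factor
   [i = n]. *)
by rewrite (bigD1 (Ordinal nd)) //= subnn mul0r (bigD1 (Ordinal nd)) //= subrr mul0r.
Qed.

Lemma horner_ffact_poly e m : (ffact_poly e).[m%:R] = (d`! * 'C(m + e, d))%:R.
Proof.
rewrite mulnC bin_ffact natr_ffact horner_prod; apply: eq_bigr => i _.
by rewrite !hornerE natrD; ring.
Qed.

Lemma horner_ffact_polyN e m : (e <= d.-1)%N ->
  (-1) ^+ d * (ffact_poly e).[- m%:R] = (d`! * 'C(m + (d.-1 - e), d))%:R.
Proof.
move=> ed; rewrite mulnC bin_ffact natr_ffact horner_prod.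
rewrite -[X in (-1) ^+ X]card_ord -prodr_const -big_split /=.
(* After the signs are absorbed the factors are [m + i - e]; replacing [i] by [d - 1 - i] on the
   right matches them one by one. *)
rewrite [RHS](reindex_inj rev_ord_inj) /=; apply: eq_bigr => i _.
rewrite !hornerE natrD !natrB // ?ltn_ord //.
have -> : d%:R = d.-1%:R + 1 :> R by rewrite natr1 prednK // (leq_ltn_trans _ (ltn_ord i)).
by rewrite -addn1 natrD; ring.
Qed.

(** * From permutations to vertices, and the final sums *)

Variable V : seq 'rV[R]_d.
Hypotheses (V_neq0 : V != [::]) (gpV : genperm (conv V)).
Local Notation P := (conv V).

Let maxface_neq0 z : exists x, maxface P z x.
Proof. by have [v _ vz] := maxface_conv z V_neq0; exists v. Qed.

Let perm_vec_injN (s : 'S_d) : injective ((- perm_vec R s) 0).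
Proof. by move=> i j /eqP; rewrite !mxE eqr_opp eqr_nat => /eqP/val_inj/perm_inj. Qed.

Let maxface_perm_of_rel y w s : perm_of_rel s (lexle y w) ->
  maxface P (perm_vec R s) = maxface (maxface P y) w.
Proof.
move=> /perm_of_relP h; apply: maxface_lex => // i j.
by rewrite perm_vec_le h.
Qed.

Lemma perm_vec_of_vertex v : is_vertex P v ->
  exists s, maxface P (perm_vec R s) = [set v]%classic.
Proof.
move=> [z zv]; have [s zs] := perm_of_lexle_exists z (@perm_vec_inj R d 1%g).
(* Here [s] is the order type of [z] with ties broken by index; such a refinement cannot shrink the
   single point [P_z]. *)
exists s; rewrite (maxface_perm_of_rel zs) zv.
have [x xs] := maxface_neq0 (perm_vec R s).
move: (xs); rewrite (maxface_perm_of_rel zs) zv => -[xv _].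
apply/seteqP; split=> [x' []//|_ ->]; split=> // x' ->; exact: lexx.
Qed.

(* [vtx s] is the vertex selected by the chamber of [s]; [prm v] is a chamber
   contained in the normal cone of the vertex [v]. *)
Variables (vtx : 'S_d -> 'rV[R]_d) (prm : 'rV[R]_d -> 'S_d).
Hypothesis vtxP : forall s, maxface P (perm_vec R s) = [set vtx s]%classic.
Hypothesis prmP : forall v, is_vertex P v ->
  maxface P (perm_vec R (prm v)) = [set v]%classic.

Let set1I (u v : 'rV[R]_d) : [set u]%classic = [set v]%classic -> u = v.
Proof. by move=> uv; have : [set v]%classic u by rewrite -uv. Qed.

Let vtx_vertex s : is_vertex P (vtx s).
Proof. by exists (perm_vec R s). Qed.

Let refvec s := perm_vec R (prm (vtx s)).

(** The reference vector depends on [s], but any [s] counted forces [P_y = {vtx s}]. So nothing is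
    counted unless [P_y] is some [{v}], and then only the order type of [(y, - w_v)] is, which
    indeed selects [v]. *)
Lemma generic_card y :
  (`[< generic P y >] : nat) = #|[pred s | perm_of_rel s (lexle y (- refvec s))]|.
Proof.
have vtxE s v : perm_of_rel s (lexle y (- refvec s)) -> v = vtx s ->
    maxface P y = [set v]%classic.
  move=> ys ->; apply/(maxface_maxfaceN _ (prmP (vtx_vertex s))).
  by rewrite -(maxface_perm_of_rel ys).
case: asboolP => [[v yv]|ny]; last first.
  apply/esym/eq_card0 => s; rewrite !inE; apply/negbTE/negP => ys.
  by apply: ny; exists (vtx s); apply: vtxE ys _.
have vv : is_vertex P v by exists y.
have [s0 ys0] := perm_of_lexle_exists y (@perm_vec_injN (prm v)).
have vs0 : vtx s0 = v.
  apply: set1I; rewrite -vtxP (maxface_perm_of_rel ys0).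
  exact/(maxface_maxfaceN _ (prmP vv)).
transitivity #|pred1 s0|; first by rewrite card1.
apply: eq_card => s; rewrite !inE.
apply/eqP/idP => [->|ys]; first by rewrite /refvec vs0.
apply: (fun h => perm_of_rel_unique h ys0); rewrite -[v](_ : vtx s = v) //.
by apply: set1I; rewrite -yv (vtxE _ _ ys erefl).
Qed.

(** The map [vtx] is a bijection from the permutations counted onto the vertices of [P_y]; the
    inverse sends [v] to the order type of [(y, w_v)]. *)
Lemma nvert_card y :
  nvert V (maxface P y) = #|[pred s | perm_of_rel s (lexle y (refvec s))]|.
Proof.
rewrite cardE -(size_map vtx); apply/perm_size/uniq_perm; first exact: undup_uniq.
  rewrite map_inj_in_uniq ?enum_uniq // => s s'; rewrite !mem_enum !inE /refvec.
  by move=> ys ys' ss'; move: ys; rewrite ss' => /perm_of_rel_unique; apply.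
move=> v; rewrite mem_undup mem_filter; apply/andP/mapP.
  move=> [/asboolP/(is_vertex_maxface _ _ gpV maxface_neq0)[yv vv] _].
  have [s ys] := perm_of_lexle_exists y (@perm_vec_inj R d (prm v)).
  have vs : vtx s = v.
    apply: set1I; rewrite -vtxP (maxface_perm_of_rel ys).
    exact/(maxface_maxface _ (prmP vv)).
  by exists s => //; rewrite mem_enum inE /refvec vs.
move=> [s]; rewrite mem_enum inE => ys ->; have vv := vtx_vertex s; split.
  apply/asboolP/(is_vertex_maxface _ _ gpV maxface_neq0); split=> //.
  apply/(maxface_maxface _ (prmP vv)).
  by rewrite -(maxface_perm_of_rel ys) vtxP.
have [u uV] := maxface_conv (perm_vec R s) V_neq0.
by rewrite vtxP => <-.
Qed.

Lemma genperm_reciprocity : exists p : {poly R},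
    size p = d.+1 /\
    (forall m : nat, (chi P m)%:R = p.[m%:R]) /\
    (forall m : nat, (-1) ^+ d * p.[- m%:R] =
       (\sum_(y : {ffun 'I_d -> 'I_m}) nvert V (maxface P (ptof R y)))%:R).
Proof.
pose e s := ascents_wrt (- refvec s) s.
have eE s : (ascents_wrt (refvec s) s + e s = d.-1)%N.
  by apply: ascents_wrtN; apply: perm_vec_inj.
have fact_neq0 : d`!%:R != 0 :> R by rewrite pnatr_eq0 -lt0n fact_gt0.
exists (d`!%:R^-1 *: \sum_s ffact_poly (e s)); split; [|split=> m].
- rewrite size_scale ?invr_neq0 //; apply/eqP; rewrite eqn_leq; apply/andP; split.
    apply: (leq_trans (size_sum _ _ _)); apply/bigmax_leqP => s _.
    by rewrite size_ffact_poly.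
  (* The leading terms cannot cancel: the coefficient of degree [d] in the sum is the number of
     permutations. *)
  rewrite ltnNge; apply/negP => /leq_sizeP/(_ d (leqnn d))/eqP.
  rewrite coef_sum (eq_bigr (fun=> 1)); last by move=> s _; apply: coef_ffact_poly.
  by rewrite sumr_const pnatr_eq0 => /eqP; apply/eqP; rewrite -lt0n;
    apply/card_gt0P; exists 1%g.
- have -> : chi P m = (\sum_(y : {ffun 'I_d -> 'I_m})
      \sum_s perm_of_rel s (lexle (ptof R y) (- refvec s)))%N.
    rewrite /chi -sum1_card big_mkcond; apply: eq_bigr => y _.
    rewrite -[LHS]/(`[< generic P (ptof R y) >] : nat) generic_card.
    by rewrite -sum1_card big_mkcond.
  rewrite exchange_big hornerZ horner_sum natr_sum mulr_sumr; apply: eq_bigr => s _.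
  rewrite horner_ffact_poly natrM mulKf //.
  by rewrite -(card_lexle s m (@perm_vec_injN (prm (vtx s)))) -sum1_card [in RHS]big_mkcond.
have -> : (\sum_(y : {ffun 'I_d -> 'I_m}) nvert V (maxface P (ptof R y)) =
    \sum_(y : {ffun 'I_d -> 'I_m}) \sum_s perm_of_rel s (lexle (ptof R y) (refvec s)))%N.
  by apply: eq_bigr => y _; rewrite nvert_card -sum1_card big_mkcond.
rewrite exchange_big hornerZ horner_sum natr_sum mulrCA !mulr_sumr; apply: eq_bigr => s _.
rewrite horner_ffact_polyN; last by rewrite -(eE s) leq_addl.
rewrite -(eE s) addnK natrM mulKf //.
by rewrite -(card_lexle s m (@perm_vec_inj _ _ (prm (vtx s)))) -sum1_card [in LHS]big_mkcond.
Qed.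

End Reciprocity.

Theorem mainTheorem6 (R : realType) (d : nat) (V : seq 'rV[R]_d) :
  V != [::] -> genperm (conv V) ->
  exists p : {poly R},
    size p = d.+1 /\
    (forall m : nat, (0 < m)%N -> (chi (conv V) m)%:R = p.[m%:R]) /\
    (forall m : nat, (0 < m)%N ->
       (-1) ^+ d * p.[- m%:R] =
       (\sum_(y : {ffun 'I_d -> 'I_m}) nvert V (maxface (conv V) (ptof R y)))%:R).
Proof.
move=> V0 gpV.
have ne z : exists x, maxface (conv V) z x.
  by have [v _ vz] := maxface_conv z V0; exists v.
have [vtx vtxP] := boolp.choice (fun s : 'S_d => maxface_perm_vec s gpV ne).
(* Choice needs a value at every point, so the identity permutation serves as default off the
   vertices. *)
have prm_ex v : exists s, is_vertex (conv V) v ->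
    maxface (conv V) (perm_vec R s) = [set v]%classic.
  have [/(perm_vec_of_vertex V0 gpV)[s sv]|nv] := pselect (is_vertex (conv V) v).
    by exists s.
  by exists 1%g.
have [prm prmP] := boolp.choice prm_ex.
have [p [sp [chip nvp]]] := genperm_reciprocity V0 gpV vtxP prmP.
by exists p; split=> //; split=> m _.
Qed.
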